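(* Let $h:\mathbb{P}_k\to\mathbb{R}$ be nondecreasing in the Löwner order and geodesically convex. Let $r\in\{1,-1\}$ and let $\Phi$ be a positive linear map from $d\times d$ Hermitian matrices to $k\times k$ Hermitian matrices sending $\mathbb{P}_d$ into $\mathbb{P}_k$. Then $\phi(S)=h(\Phi(S^r))$ is geodesically convex on $\mathbb{P}_d$.
   Context: $\mathbb{P}_n$ denotes the $n\times n$ Hermitian positive definite matrices; $\preceq$ is the Löwner order. A linear map $\Phi$ is positive if $\Phi(A)\succeq0$ whenever $A\succeq0$. For $A,B\in\mathbb{P}_n$, $t\in[0,1]$, $A\#_tB:=A^{1/2}(A^{-1/2}BA^{-1/2})^tA^{1/2}$. A function $\phi$ on $\mathbb{P}_n$ is geodesically convex if $\phi(A\#_tB)\le(1-t)\phi(A)+t\phi(B)$ for all $A,B\in\mathbb{P}_n$, $t\in[0,1]$. $h$ nondecreasing means $X\preceq Y\Rightarrow h(X)\le h(Y)$. *)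

(* Defs.v *)
(* MathComp-Analysis (powR) + real_closed complex numbers R[i]. *)
From HB Require Import structures.
From mathcomp Require Import all_boot all_order all_algebra.
From mathcomp Require Import complex.
From mathcomp Require Import all_classical all_reals.
From mathcomp Require Import exp.
Set Implicit Arguments. Unset Strict Implicit. Unset Printing Implicit Defensive.
Import Order.TTheory GRing.Theory Num.Theory ComplexField.
Local Open Scope ring_scope.
Local Open Scope sesquilinear_scope.

Section Defs.
Variable R : realType.
Local Notation C := (R[i]).

(* Hermitian: A = A^* (conjugate transpose); library notion [hermsymmx]. *)
Definition hermmx n (A : 'M[C]_n) : Prop := A \is hermsymmx.

(* Positive semidefinite / positive definite Hermitian matrices. *)
Definition psdmx n (A : 'M[C]_n) : Prop :=
  hermmx A /\ forall v : 'rV[C]_n, 0 <= (v *m A *m v ^t*) 0 0.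

Definition pdmx n (A : 'M[C]_n) : Prop :=
  hermmx A /\ forall v : 'rV[C]_n, v != 0 -> 0 < (v *m A *m v ^t*) 0 0.

(* Loewner order: A <= B iff B - A is positive semidefinite. *)
Definition loewner n (A B : 'M[C]_n) : Prop := psdmx (B - A).

(* Real power A^t of a positive definite matrix via the spectral decomposition
   A = U^-1 diag(lambda) U (U unitary), i.e. A^t = U^-1 diag(lambda^t) U. *)
Definition mxpowR n (A : 'M[C]_n) (t : R) : 'M[C]_n :=
  invmx (spectralmx A)
  *m diag_mx (map_mx (fun z : C => ((complex.Re z) `^ t)%:C%C) (spectral_diag A))
  *m spectralmx A.

(* Weighted geometric mean A #_t B = A^{1/2} (A^{-1/2} B A^{-1/2})^t A^{1/2}. *)
Definition geomean n (A B : 'M[C]_n) (t : R) : 'M[C]_n :=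
  mxpowR A (2^-1) *m
  mxpowR (mxpowR A (- 2^-1) *m B *m mxpowR A (- 2^-1)) t *m
  mxpowR A (2^-1).

(* Geodesic convexity on P_n. *)
Definition geo_convex n (f : 'M[C]_n -> R) : Prop :=
  forall A B : 'M[C]_n, pdmx A -> pdmx B -> forall t : R, 0 <= t <= 1 ->
    f (geomean A B t) <= (1 - t) * f A + t * f B.

End Defs.

(* Main.v *)
(* Simultaneous diagonalisation writes A = G^* G, B = G^* D G with D a positive
   diagonal matrix, and then A #_t B = G^* D^t G; moreover
   (A #_t B)^-1 = G^-1 (D^-1)^t G^-*, so both r = 1 and r = -1 reduce to Ando's
   inequality Phi(G^* D^t G) <= Phi(G^* G) #_t Phi(G^* D G), after which
   monotonicity and geodesic convexity of h conclude.

   Expanding along the rows g_i of G, Phi(G^* D^t G) is the sum of the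
   d_i^t Phi(g_i^* g_i); diagonalising Phi(G^* G) and Phi(G^* D G)
   simultaneously, Ando's inequality becomes: if N_i >= 0, sum N_i = 1 and
   sum d_i N_i = F is diagonal, then sum d_i^t N_i <= F^t for t in [0, 1].
   The set of such t is closed and contains 0 and 1, with equality. It is stable
   under midpoints by a Cauchy-Schwarz argument that uses only the positivity of
   each N_i, so Phi need not be 2-positive. *)
Require Import Defs.
From HB Require Import structures.
From mathcomp Require Import all_boot all_order all_algebra.
From mathcomp Require Import complex ring.
From mathcomp Require Import all_classical all_reals.
From mathcomp Require Import topology normedtype sequences exp.
Set Implicit Arguments. Unset Strict Implicit. Unset Printing Implicit Defensive.
Import Order.TTheory GRing.Theory Num.Theory ComplexField.
Import numFieldNormedType.Exports.
Local Open Scope ring_scope.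
Local Open Scope sesquilinear_scope.

(** * Hermitian forms, positivity and congruence *)

Section HermitianForms.
Variable C : numClosedFieldType.

Lemma trmxC_mul m n p (A : 'M[C]_(m, n)) (B : 'M[C]_(n, p)) :
  (A *m B)^t* = B^t* *m A^t*.
Proof. by rewrite trmx_mul map_mxM. Qed.

Lemma trmxC_unit n (A : 'M[C]_n) : (A^t* \in unitmx) = (A \in unitmx).
Proof. by rewrite map_unitmx unitmx_tr. Qed.

Lemma trmxC_inv n (A : 'M[C]_n) : (invmx A)^t* = invmx (A^t*).
Proof. by rewrite trmx_inv map_invmx. Qed.

Lemma trmxC1 n : (1%:M : 'M[C]_n)^t* = 1%:M.
Proof. by rewrite trmx1 map_mx1. Qed.

Lemma trmxC_diag_real n (d : 'rV[C]_n) :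
  (forall i, d 0 i \is Num.real) -> (diag_mx d)^t* = diag_mx d.
Proof.
move=> d_real; rewrite tr_diag_mx map_diag_mx; congr diag_mx.
by apply/rowP => i; rewrite !mxE /= conj_Creal.
Qed.

(* [herm], [psd], [pd] and [lowner], and later [gmean], repeat the notions of
   [Defs] over an arbitrary [C]; see [psdmxE], [pdmxE] and [geomeanE]. *)
Definition herm n (A : 'M[C]_n) := A^t* = A.

Definition qform n (A : 'M[C]_n) (u v : 'rV[C]_n) : C := (u *m A *m v^t*) 0 0.

Definition psd n (A : 'M[C]_n) := herm A /\ forall v, 0 <= qform A v v.

Definition pd n (A : 'M[C]_n) := herm A /\ forall v, v != 0 -> 0 < qform A v v.

Definition lowner n (A B : 'M[C]_n) := psd (B - A).

Lemma hermB n (A B : 'M[C]_n) : herm A -> herm B -> herm (A - B).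
Proof. by move=> hA hB; rewrite /herm linearB map_mxB hA hB. Qed.

Lemma herm_lin m n (c : 'I_m -> C) (A : 'I_m -> 'M[C]_n) :
  (forall i, c i \is Num.real) -> (forall i, herm (A i)) ->
  herm (\sum_i c i *: A i).
Proof.
move=> c_real hA; rewrite /herm linear_sum raddf_sum.
by apply: eq_bigr => i _; rewrite linearZ /= map_mxZ /= conj_Creal // hA.
Qed.

Lemma herm_congr m n (A : 'M[C]_n) (Q : 'M[C]_(n, m)) :
  herm A -> herm (Q^t* *m A *m Q).
Proof. by move=> hA; rewrite /herm !trmxC_mul trmxCK hA mulmxA. Qed.

Lemma qform_congr m n (A : 'M[C]_n) (Q : 'M[C]_(n, m)) u v :
  qform (Q^t* *m A *m Q) u v = qform A (u *m Q^t*) (v *m Q^t*).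
Proof. by rewrite /qform trmxC_mul trmxCK !mulmxA. Qed.

Lemma qformB n (A B : 'M[C]_n) u v : qform (A - B) u v = qform A u v - qform B u v.
Proof. by rewrite /qform mulmxBr mulmxBl !mxE. Qed.

Lemma qform_lin m n (c : 'I_m -> C) (A : 'I_m -> 'M[C]_n) u v :
  qform (\sum_i c i *: A i) u v = \sum_i c i * qform (A i) u v.
Proof.
rewrite /qform mulmx_sumr mulmx_suml summxE; apply: eq_bigr => i _.
by rewrite -scalemxAr -scalemxAl mxE.
Qed.

Lemma qform_conj n (A : 'M[C]_n) u v : herm A -> (qform A u v)^* = qform A v u.
Proof.
move=> hA; have -> : (qform A u v)^* = ((u *m A *m v^t*)^t*) 0 0
  by rewrite [RHS]mxE /= [in RHS]mxE.
by rewrite !trmxC_mul trmxCK hA mulmxA.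
Qed.

(* Nonnegativity of [qform A] at [a u - b v]. *)
Lemma psd_qform_AGM n (A : 'M[C]_n) u v (a b : C) : psd A ->
  a \is Num.real -> b \is Num.real ->
  a * b * (qform A u v + qform A v u) <=
  a * a * qform A u u + b * b * qform A v v.
Proof.
move=> [_ /(_ (a *: u - b *: v)) pA] a_real b_real.
rewrite -subr_ge0; suff <- : qform A (a *: u - b *: v) (a *: u - b *: v) =
    a * a * qform A u u + b * b * qform A v v -
    a * b * (qform A u v + qform A v u) by [].
have aC : (a *: u - b *: v)^t* = a *: u^t* - b *: v^t*.
  apply/matrixP => i j.
  by rewrite !mxE rmorphB !rmorphM /= (conj_Creal a_real) (conj_Creal b_real).
rewrite /qform aC !mulmxBl !mulmxBr -!scalemxAr -!scalemxAl.
set x1 := u *m A *m u^t*; set x2 := u *m A *m v^t*.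
set x3 := v *m A *m u^t*; set x4 := v *m A *m v^t*.
by rewrite !mxE; ring.
Qed.

Lemma psd_congr m n (A : 'M[C]_n) (Q : 'M[C]_(n, m)) :
  psd A -> psd (Q^t* *m A *m Q).
Proof.
by move=> [hA pA]; split=> [|v]; [exact: herm_congr|rewrite qform_congr].
Qed.

Lemma pd_congr n (A Q : 'M[C]_n) : Q \in unitmx -> pd A -> pd (Q^t* *m A *m Q).
Proof.
move=> Qu [hA pA]; split=> [|v v0]; first exact: herm_congr.
rewrite qform_congr; apply/pA/(contra_neq _ v0) => vQ0.
by rewrite -[v](@mulmxK _ _ _ (Q^t*)) ?trmxC_unit // vQ0 mul0mx.
Qed.

Lemma pd_psd n (A : 'M[C]_n) : pd A -> psd A.
Proof.
move=> [hA pA]; split=> // v; have [->|/pA/ltW//] := eqVneq v 0.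
by rewrite /qform !mul0mx mxE.
Qed.

Lemma pd1 n : pd (1%:M : 'M[C]_n).
Proof.
split; first exact: trmxC1.
by move=> v v0; rewrite /qform mulmx1 -dotmxE; exact: dotmx_is_dotmx.
Qed.

Lemma psd_diag n (d : 'rV[C]_n) : (forall i, 0 <= d 0 i) -> psd (diag_mx d).
Proof.
move=> d_ge0; split; first by apply: trmxC_diag_real => i; rewrite ger0_real.
move=> v; rewrite /qform mxE sumr_ge0 // => i _.
by rewrite mul_mx_diag !mxE mulrAC mulr_ge0 // mul_conjC_ge0.
Qed.

Lemma psd_delta n (i : 'I_n) : psd (delta_mx i i : 'M[C]_n).
Proof.
have -> : delta_mx i i = diag_mx (delta_mx 0 i) :> 'M[C]_n.
  apply/matrixP => j k; rewrite !mxE eqxx /=.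
  have [->|jk] := eqVneq j k; first by rewrite andbb mulr1n.
  by have [ji|//] := eqVneq j i; rewrite -ji eq_sym (negbTE jk).
by apply: psd_diag => j; rewrite !mxE ler0n.
Qed.

Lemma psd_rank1 n (g : 'rV[C]_n) : psd (g^t* *m g).
Proof. by rewrite -[g^t*]mulmx1; exact/psd_congr/pd_psd/pd1. Qed.

Lemma invmx_eq n (X Y : 'M[C]_n) : X *m Y = 1%:M -> invmx X = Y.
Proof.
by move=> XY; have [Xu _] := mulmx1_unit XY; rewrite -[RHS](mulKmx Xu) XY mulmx1.
Qed.

Lemma row_unitmx_neq0 n (U : 'M[C]_n) i : U \in unitmx -> row i U != 0.
Proof.
move=> Uu; apply/eqP => Ui0; have := congr1 (mulmx^~ (invmx U)) Ui0.
rewrite -row_mul mulmxV // mul0mx => /rowP/(_ i)/eqP.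
by rewrite !mxE eqxx oner_eq0.
Qed.

Lemma row_mul_diag m n (d : 'rV[C]_n) (U : 'M[C]_(n, m)) i :
  row i (diag_mx d *m U) = d 0 i *: row i U.
Proof. by apply/rowP => j; rewrite mul_diag_mx !mxE. Qed.

(** Each term is a real multiple of a rank-one positive semidefinite matrix when [d] is real, so a
    positive linear map can be applied term by term. *)
Lemma congr_diag_sum m n (d : 'rV[C]_n) (G : 'M[C]_(n, m)) :
  G^t* *m diag_mx d *m G = \sum_i d 0 i *: ((row i G)^t* *m row i G).
Proof.
apply/matrixP => j k; rewrite summxE !mxE; apply: eq_bigr => i _.
by rewrite mul_mx_diag !mxE big_ord1 !mxE mulrAC mulrC mulrA.
Qed.

(** * Spectral decomposition and an eigenvalue test for the Löwner order *)

Lemma herm_hermsym n (A : 'M[C]_n) : (A \is hermsymmx) <-> herm A.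
Proof.
split; first by move/is_hermitianmxP; rewrite expr0 scale1r => AE; exact: esym AE.
by move=> hA; apply/is_hermitianmxP; rewrite expr0 scale1r hA.
Qed.

Lemma spectral_mulVmx n (A : 'M[C]_n) : (spectralmx A)^t* *m spectralmx A = 1%:M.
Proof. exact/mulmx1C/unitarymxP/spectral_unitarymx. Qed.

Lemma herm_spectral n (A : 'M[C]_n) : herm A ->
  A = (spectralmx A)^t* *m diag_mx (spectral_diag A) *m spectralmx A.
Proof.
move=> /herm_hermsym/hermitian_normalmx/orthomx_spectralP {1}->.
by rewrite invmx_unitary ?spectral_unitarymx.
Qed.

Lemma herm_row_spectral n (A : 'M[C]_n) i : herm A ->
  row i (spectralmx A) *m A = spectral_diag A 0 i *: row i (spectralmx A).
Proof.
move=> hA; rewrite {2}(herm_spectral hA) -row_mul !mulmxA.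
have /unitarymxP -> := spectral_unitarymx A.
by rewrite mul1mx row_mul_diag.
Qed.

Lemma herm_spectral_real n (A : 'M[C]_n) i : herm A ->
  spectral_diag A 0 i \is Num.real.
Proof. by move=> /herm_hermsym/hermitian_spectral_diag_real/mxOverP. Qed.

(** The rows of [spectralmx A] are left eigenvectors; on such a row the form equals the eigenvalue
    times a positive squared norm. *)
Lemma pd_spectral_gt0 n (A : 'M[C]_n) i : pd A -> 0 < spectral_diag A 0 i.
Proof.
move=> [hA pA]; have u0 := row_unitmx_neq0 i (spectral_unit A).
have := pA _ u0; rewrite /qform herm_row_spectral // -scalemxAl mxE.
by rewrite pmulr_lgt0 // -dotmxE; exact: dotmx_is_dotmx.
Qed.

(* The relevant [w] are [u P^-1], with [u] a left eigenvector of
   [P^-1 Z P^-1]. *)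
Lemma lowner_eigen n (Z P : 'M[C]_n) : herm Z -> herm P -> P \in unitmx ->
  (forall (w : 'rV[C]_n) (mu : C), w != 0 -> mu \is Num.real ->
     w *m Z = mu *: (w *m (P *m P)) -> mu <= 1) ->
  lowner Z (P *m P).
Proof.
move=> hZ hP Pu mu_le1.
have [K hK ZE] : exists2 K : 'M[C]_n, herm K & Z = P *m K *m P.
  have hP' : (invmx P)^t* = invmx P by rewrite trmxC_inv hP.
  exists (invmx P *m Z *m invmx P); first by rewrite -{1}hP'; exact: herm_congr.
  by rewrite !mulmxA mulmxV // mul1mx mulmxKV.
pose U := spectralmx K; pose l := spectral_diag K.
have l_le1 i : l 0 i <= 1.
  apply: (mu_le1 (row i U *m invmx P)); last 1 first.
  - rewrite ZE !mulmxA !mulmxKV // /U herm_row_spectral //.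
    by rewrite -scalemxAl.
  - apply: (contra_neq _ (row_unitmx_neq0 i (spectral_unit K))) => uP0.
    by rewrite -[row i _](mulmxKV Pu) uP0 mul0mx.
  - exact: herm_spectral_real.
rewrite /lowner.
(* With [Z = P K P], the gap is [P (1 - K) P], and [U] diagonalises [1 - K] with entries [1 - l]. *)
have -> : P *m P - Z = (U *m P)^t* *m diag_mx (const_mx 1 - l) *m (U *m P).
  rewrite trmxC_mul hP ZE {1}(herm_spectral hK) -/U -/l linearB /=.
  rewrite diag_const_mx mulmxBr mulmxBl mulmx1 !mulmxA; congr (_ *m _ - _).
  by rewrite -mulmxA spectral_mulVmx mulmx1.
by apply/psd_congr/psd_diag => i; rewrite !mxE subr_ge0.
Qed.

End HermitianForms.

(** * Density of midpoint-closed sets *)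

(** Bisection keeps an interval around [t] with both endpoints in [T] and length [2^-k]; its left
    endpoint is the required [s]. *)
Lemma midpoint_dense (R : archiRealFieldType) (T : R -> Prop) (t : R) :
  T 0 -> T 1 ->
  (forall s u, T s -> T u -> T ((s + u) / 2)) -> 0 <= t <= 1 ->
  forall eps : R, 0 < eps -> exists2 s, `|t - s| < eps & T s.
Proof.
move=> T0 T1 Tmid /andP[t0 t1].
have bisect k : exists a b : R, [/\ T a, T b, a <= t <= b & b - a = 2^-1 ^+ k].
  elim: k => [|k [a [b [Ta Tb /andP[at_ tb] ab]]]].
    by exists 0, 1; rewrite t0 t1 subr0 expr0.
  have ab2 : (a + b) / 2 - a = (b - a) / 2 by field.
  have ba2 : b - (a + b) / 2 = (b - a) / 2 by field.
  have [tm|/ltW tm] := leP t ((a + b) / 2).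
    exists a, ((a + b) / 2); split; rewrite ?at_ //; first exact: Tmid.
    by rewrite ab2 ab exprSr.
  exists ((a + b) / 2), b; split; rewrite ?tm //; first exact: Tmid.
  by rewrite ba2 ab exprSr.
move=> eps eps_gt0.
have [k hk] : exists k, (2^-1 : R) ^+ k < eps.
  (* With [k] this bound, [eps^-1 < k <= 2^k]. *)
  exists (Num.bound eps^-1); rewrite exprVn -[ltRHS]invrK ltf_pV2 ?posrE //.
  - apply: (lt_le_trans (archi_boundP _)); first by rewrite invr_ge0 ltW.
    by rewrite -natrX ler_nat ltnW // ltn_expl.
  - by rewrite exprn_gt0.
  - by rewrite invr_gt0.
have [a [b [Ta _ /andP[at_ tb] ab]]] := bisect k.
exists a => //; rewrite ger0_norm ?subr_ge0 //.
by apply: le_lt_trans hk; rewrite -ab lerD2r.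
Qed.

(** * Real powers of positive diagonal matrices *)

Section PowerMean.
(* [pw t z] stands for [z `^ t]; [pw_closure] is what remains of its continuity
   in [t]. *)
Variables (R : realType) (C : numClosedFieldType) (pw : R -> C -> C).
Hypothesis pw_gt0 : forall t x, 0 < x -> 0 < pw t x.
Hypothesis pwD : forall s t x, 0 < x -> pw (s + t) x = pw s x * pw t x.
Hypothesis pw1 : forall x, 0 < x -> pw 1 x = x.
Hypothesis pw_closure : forall (I : finType) (a c : I -> C) (t : R),
  (forall i, 0 < a i) -> (forall i, c i \is Num.real) ->
  (forall eps : R, 0 < eps ->
     exists2 s, `|t - s| < eps & 0 <= \sum_i pw s (a i) * c i) ->
  0 <= \sum_i pw t (a i) * c i.

(** By [pwD] at [0 + 0], [pw 0 x] is idempotent, and it is nonzero. *)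
Lemma pw0 x : 0 < x -> pw 0 x = 1.
Proof.
move=> x_gt0; apply: (mulfI (lt0r_neq0 (pw_gt0 0 x_gt0))).
by rewrite -pwD // addr0 mulr1.
Qed.

Definition dpow n (e : 'rV[C]_n) t := diag_mx (map_mx (pw t) e).

Lemma dpowD n (e : 'rV[C]_n) s t : (forall i, 0 < e 0 i) ->
  dpow e s *m dpow e t = dpow e (s + t).
Proof.
move=> e_gt0; rewrite /dpow mulmx_diag; congr diag_mx.
by apply/rowP => i; rewrite !mxE pwD.
Qed.

Lemma dpow0 n (e : 'rV[C]_n) : (forall i, 0 < e 0 i) -> dpow e 0 = 1%:M.
Proof.
move=> e_gt0; rewrite /dpow -diag_const_mx; congr diag_mx.
by apply/rowP => i; rewrite !mxE pw0.
Qed.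

Lemma dpow1 n (e : 'rV[C]_n) : (forall i, 0 < e 0 i) -> dpow e 1 = diag_mx e.
Proof.
by move=> e_gt0; congr diag_mx; apply/rowP => i; rewrite !mxE pw1.
Qed.

Lemma dpow_herm n (e : 'rV[C]_n) t : (forall i, 0 < e 0 i) -> herm (dpow e t).
Proof.
by move=> e_gt0; apply: trmxC_diag_real => i; rewrite mxE gtr0_real ?pw_gt0.
Qed.

Lemma dpow_unit n (e : 'rV[C]_n) t : (forall i, 0 < e 0 i) ->
  dpow e t \in unitmx.
Proof.
move=> e_gt0; have /mulmx1_unit[u _] : dpow e t *m dpow e (- t) = 1%:M.
  by rewrite dpowD // subrr dpow0.
exact: u.
Qed.

(** The matrix is the square of the Hermitian invertible [dpow e (t / 2)], hence a congruence of the
    identity. *)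
Lemma pd_dpow n (e : 'rV[C]_n) t : (forall i, 0 < e 0 i) -> pd (dpow e t).
Proof.
move=> e_gt0; have := pd_congr (dpow_unit (t / 2) e_gt0) (pd1 C n).
by rewrite mulmx1 dpow_herm // dpowD // -splitr.
Qed.

Lemma dpow_sum n (e : 'rV[C]_n) t :
  dpow e t = \sum_i pw t (e 0 i) *: delta_mx i i.
Proof.
by rewrite /dpow diag_mx_sum_delta; apply: eq_bigr => i _; rewrite mxE.
Qed.

(** * Jensen's inequality for powers with positive semidefinite weights *)

Section Jensen.
Variables (m n : nat) (N : 'I_m -> 'M[C]_n) (e : 'rV[C]_m) (f : 'rV[C]_n).
Hypothesis N_psd : forall i, psd (N i).
Hypothesis e_gt0 : forall i, 0 < e 0 i.
Hypothesis f_gt0 : forall i, 0 < f 0 i.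

Let Z t := \sum_i pw t (e 0 i) *: N i.

Let Z_herm t : herm (Z t).
Proof.
by apply: herm_lin => i; [rewrite gtr0_real ?pw_gt0 | case: (N_psd i)].
Qed.

(* If [w Z_m = mu w f^m] with [m = (s + t) / 2], pairing with
   [w f^((s - t) / 2)] makes both sides of the Cauchy-Schwarz bound equal to
   [w f^s w^*], so that [mu <= 1]. *)
Lemma power_jensen_midpoint s t :
  lowner (Z s) (dpow f s) -> lowner (Z t) (dpow f t) ->
  lowner (Z ((s + t) / 2)) (dpow f ((s + t) / 2)).
Proof.
move=> [_ Zs] [_ Zt]; set q := (s + t) / 2; pose p := (s - t) / 2.
have -> : dpow f q = dpow f (q / 2) *m dpow f (q / 2).
  by rewrite dpowD // -splitr.
apply: lowner_eigen; [exact: Z_herm|exact: dpow_herm|exact: dpow_unit|].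
move=> w mu w0 mu_real; rewrite dpowD // -splitr => wZ.
pose y := w *m dpow f p; pose Q := qform (dpow f s) w w.
have Q_gt0 : 0 < Q by have [_] := pd_dpow s f_gt0; apply.
have yC : y^t* = dpow f p *m w^t* by rewrite trmxC_mul dpow_herm.
have wZy : qform (Z q) w y = mu * Q.
  rewrite /qform wZ yC -!scalemxAl mxE; congr (_ * _).
  rewrite /Q /qform !mulmxA -(mulmxA w) dpowD //; congr ((_ *m dpow f _ *m _) 0 0).
  by rewrite /q /p; field.
have yZw : qform (Z q) y w = mu * Q.
  by rewrite -qform_conj // wZy conj_Creal // realM // gtr0_real.
have yZy : qform (dpow f t) y y = Q.
  rewrite /qform yC /y !mulmxA -(mulmxA w) dpowD // -(mulmxA w) dpowD //.
  by congr ((_ *m dpow f _ *m _) 0 0); rewrite /p; field.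
have : qform (Z q) w y + qform (Z q) y w <= qform (Z s) w w + qform (Z t) y y.
  (* Termwise, [psd_qform_AGM] is applied to [N i] with coefficients [e_i^(s/2)] and [e_i^(t/2)],
     whose product is [e_i^q]. *)
  rewrite !qform_lin -!big_split /=; apply: ler_sum => i _.
  have qE u : pw u (e 0 i) = pw (u / 2) (e 0 i) * pw (u / 2) (e 0 i).
    by rewrite -pwD // -splitr.
  have -> : pw q (e 0 i) = pw (s / 2) (e 0 i) * pw (t / 2) (e 0 i).
    by rewrite -pwD // -mulrDl.
  rewrite -mulrDr (qE s) (qE t).
  by apply: psd_qform_AGM => //; rewrite gtr0_real ?pw_gt0.
(* Both forms on the right are at most [Q], so [2 mu Q <= 2 Q] with [Q > 0]. *)
move: (Zs w) (Zt y); rewrite !qformB !subr_ge0 yZy -/Q => Zs_le Zt_le.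
rewrite wZy yZw => /le_trans/(_ (lerD Zs_le Zt_le)).
by rewrite -mulr2n -[leRHS]mulr2n lerMn2r /= ger_pMl.
Qed.

(** For a fixed vector, the form of the gap is a finite real combination of powers of positive
    numbers, to which [pw_closure] applies. *)
Lemma power_jensen_closure t :
  (forall eps : R, 0 < eps ->
     exists2 s, `|t - s| < eps & lowner (Z s) (dpow f s)) ->
  lowner (Z t) (dpow f t).
Proof.
move=> cl; split; first by apply: hermB => //; exact: dpow_herm.
move=> v.
(* The disjoint union of indices merges the powers of [f] and those of [e], the latter with a minus
   sign, into one sum. *)
pose a (k : 'I_n + 'I_m) := match k with inl j => f 0 j | inr i => e 0 i end.
pose c (k : 'I_n + 'I_m) := match k with
  inl j => qform (delta_mx j j) v v | inr i => - qform (N i) v v end.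
have gapE s : qform (dpow f s - Z s) v v = \sum_k pw s (a k) * c k.
  rewrite qformB dpow_sum !qform_lin big_sumType /= -sumrN.
  by congr (_ + _); apply: eq_bigr => i _; rewrite mulrN.
rewrite gapE; apply: pw_closure.
- by case.
- case=> i; last rewrite realN; rewrite ger0_real //.
    by have [_] := psd_delta C i; apply.
  by have [_] := N_psd i; apply.
- move=> eps /cl[s ts [_ /(_ v)]]; rewrite gapE => Zs; by exists s.
Qed.

Hypothesis N_sum : \sum_i N i = 1%:M.
Hypothesis eN_sum : \sum_i e 0 i *: N i = diag_mx f.

Lemma power_jensen t : 0 <= t <= 1 -> lowner (Z t) (dpow f t).
Proof.
move=> t01; apply: power_jensen_closure.
have psd0 : psd (0 : 'M[C]_n).
  split=> [|v]; first by rewrite /herm trmx0 map_mx0.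
  by rewrite /qform mulmx0 mul0mx mxE.
apply: midpoint_dense t01 => //; last exact: power_jensen_midpoint.
- rewrite /lowner dpow0 // -N_sum /Z.
  by under [X in _ - X]eq_bigr do rewrite pw0 // scale1r; rewrite subrr.
- rewrite /lowner dpow1 // -eN_sum /Z.
  by under [X in _ - X]eq_bigr do rewrite pw1 //; rewrite subrr.
Qed.

End Jensen.

(** Congruence by [H^-1] turns the [M i] into weights [N i] summing to the identity; congruence by
    [H] carries the inequality back. *)
Lemma power_jensen_congr m n (M : 'I_m -> 'M[C]_n) (e : 'rV[C]_m)
    (f : 'rV[C]_n) (H : 'M[C]_n) t :
  (forall i, psd (M i)) -> (forall i, 0 < e 0 i) -> (forall i, 0 < f 0 i) ->
  H \in unitmx -> \sum_i M i = H^t* *m H ->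
  \sum_i e 0 i *: M i = H^t* *m diag_mx f *m H -> 0 <= t <= 1 ->
  lowner (\sum_i pw t (e 0 i) *: M i) (H^t* *m dpow f t *m H).
Proof.
move=> M_psd e_gt0 f_gt0 Hu M_sum eM_sum t01.
pose N i := (invmx H)^t* *m M i *m invmx H.
have Hu' : H^t* \in unitmx by rewrite trmxC_unit.
have congr_sum (a : 'I_m -> C) :
    \sum_i a i *: N i = (invmx H)^t* *m (\sum_i a i *: M i) *m invmx H.
  rewrite mulmx_sumr mulmx_suml; apply: eq_bigr => i _.
  by rewrite -scalemxAr -scalemxAl.
have cancel_congr (X : 'M[C]_n) : (invmx H)^t* *m (H^t* *m X *m H) *m invmx H = X.
  by rewrite trmxC_inv !mulmxA mulVmx // mul1mx mulmxK.
have congr_cancel (X : 'M[C]_n) : H^t* *m ((invmx H)^t* *m X *m invmx H) *m H = X.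
  by rewrite trmxC_inv !mulmxA mulmxV // mul1mx mulmxKV.
have := @power_jensen m n N e f _ e_gt0 f_gt0 _ _ t t01.
rewrite !congr_sum eM_sum cancel_congr => jensen.
have {jensen} : lowner ((invmx H)^t* *m (\sum_i pw t (e 0 i) *: M i) *m invmx H)
                (dpow f t).
  apply: jensen => //; first by move=> i; exact: psd_congr.
  have := congr_sum (fun=> 1); under eq_bigr do rewrite scale1r.
  under [X in _ *m X *m _]eq_bigr do rewrite scale1r.
  by rewrite M_sum => ->; rewrite -[H^t*]mulmx1 cancel_congr.
move=> /(psd_congr H); rewrite /lowner mulmxBr mulmxBl.
by rewrite congr_cancel.
Qed.

(** * Matrix powers and the weighted geometric mean *)

Definition mpow n (A : 'M[C]_n) t :=
  invmx (spectralmx A) *m diag_mx (map_mx (pw t) (spectral_diag A))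
  *m spectralmx A.

Definition gmean n (A B : 'M[C]_n) t :=
  mpow A (2^-1) *m mpow (mpow A (- 2^-1) *m B *m mpow A (- 2^-1)) t
  *m mpow A (2^-1).

Lemma mpowE n (A : 'M[C]_n) t :
  mpow A t = (spectralmx A)^t* *m dpow (spectral_diag A) t *m spectralmx A.
Proof. by rewrite /mpow invmx_unitary ?spectral_unitarymx. Qed.

Lemma mpowD n (A : 'M[C]_n) s t : pd A -> mpow A s *m mpow A t = mpow A (s + t).
Proof.
move=> pA; rewrite !mpowE -dpowD => [|i]; last exact: pd_spectral_gt0.
have /unitarymxP UU := spectral_unitarymx A.
by rewrite !mulmxA -(mulmxA _ (spectralmx A)) UU mulmx1.
Qed.

Lemma mpow0 n (A : 'M[C]_n) : pd A -> mpow A 0 = 1%:M.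
Proof.
move=> pA; rewrite mpowE dpow0 => [|i]; last exact: pd_spectral_gt0.
by rewrite mulmx1 spectral_mulVmx.
Qed.

Lemma mpow1 n (A : 'M[C]_n) : pd A -> mpow A 1 = A.
Proof.
move=> pA; rewrite mpowE dpow1 => [|i]; last exact: pd_spectral_gt0.
by rewrite -herm_spectral //; case: pA.
Qed.

Lemma mpow_herm n (A : 'M[C]_n) t : pd A -> herm (mpow A t).
Proof.
move=> pA; rewrite mpowE; apply/herm_congr/dpow_herm => i.
exact: pd_spectral_gt0.
Qed.

(** Take [G = V A^{1/2}], where the unitary [V] diagonalises [A^{-1/2} B A^{-1/2}] with eigenvalues
    [e]. The same [G] and [e] serve for every [t]. *)
Lemma gmean_diag n (A B : 'M[C]_n) : pd A -> pd B ->
  exists (G : 'M[C]_n) (e : 'rV[C]_n),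
  [/\ G \in unitmx, forall i, 0 < e 0 i, A = G^t* *m G,
      B = G^t* *m diag_mx e *m G &
      forall t, gmean A B t = G^t* *m dpow e t *m G].
Proof.
move=> pA pB; set S := mpow A (2^-1); set S' := mpow A (- 2^-1).
have hS : S^t* = S by exact: mpow_herm.
have hS' : S'^t* = S' by exact: mpow_herm.
have SS' : S *m S' = 1%:M by rewrite mpowD // subrr mpow0.
have S'S : S' *m S = 1%:M by rewrite mpowD // addNr mpow0.
have SS : S *m S = A by rewrite mpowD // -div1r -splitr mpow1.
have gE t : gmean A B t = S *m mpow (S' *m B *m S') t *m S by [].
(* From here [S] and [S'] are known only through these six relations. *)
move: S S' hS hS' SS' S'S SS gE => S S' hS hS' SS' S'S SS gE.
have [S'u Su] := mulmx1_unit S'S.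
have pX : pd (S' *m B *m S') by rewrite -{1}hS'; exact: pd_congr.
set V := spectralmx (S' *m B *m S'); set e := spectral_diag (S' *m B *m S').
have V'V : V^t* *m V = 1%:M by exact: spectral_mulVmx.
have XE : S' *m B *m S' = V^t* *m diag_mx e *m V by case: pX => /herm_spectral.
exists (V *m S), e; split.
- by rewrite unitmx_mul Su andbT spectral_unit.
- by move=> i; exact: pd_spectral_gt0.
- by rewrite trmxC_mul hS mulmxA -(mulmxA S) V'V mulmx1 SS.
- rewrite trmxC_mul hS !mulmxA -(mulmxA S) -(mulmxA S).
  by rewrite -XE !mulmxA SS' mul1mx -mulmxA S'S mulmx1.
- by move=> t; rewrite gE mpowE trmxC_mul hS !mulmxA.
Qed.

(** * Ando's inequality and geodesic convexity through a positive map *)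

Section PositiveMap.
Variables (d k : nat) (Phi : 'M[C]_d -> 'M[C]_k).
Hypothesis Phi_lin : forall (a : C) (A B : 'M[C]_d), a \is Num.real ->
  herm A -> herm B -> Phi (a *: A + B) = a *: Phi A + Phi B.
Hypothesis Phi_psd : forall A, psd A -> psd (Phi A).
Hypothesis Phi_pd : forall A, pd A -> pd (Phi A).

Lemma Phi_sum m (c : 'I_m -> C) (A : 'I_m -> 'M[C]_d) :
  (forall i, c i \is Num.real) -> (forall i, herm (A i)) ->
  Phi (\sum_i c i *: A i) = \sum_i c i *: Phi (A i).
Proof.
have herm0 n : herm (0 : 'M[C]_n) by rewrite /herm trmx0 map_mx0.
(* Linearity at [1 *: 0 + 0] gives [Phi 0 = Phi 0 + Phi 0]. *)
have Phi0 : Phi 0 = 0.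
  have := Phi_lin (real1 _) (herm0 d) (herm0 d).
  by rewrite !scale1r addr0 => /eqP; rewrite -subr_eq subrr eq_sym => /eqP.
elim: m c A => [|m IH] c A c_real hA; first by rewrite !big_ord0.
rewrite !big_ord_recl Phi_lin ?IH //; exact: herm_lin.
Qed.

Lemma ando_inequality (G : 'M[C]_d) (e : 'rV[C]_d) t : G \in unitmx ->
  (forall i, 0 < e 0 i) -> 0 <= t <= 1 ->
  lowner (Phi (G^t* *m dpow e t *m G))
         (gmean (Phi (G^t* *m G)) (Phi (G^t* *m diag_mx e *m G)) t).
Proof.
move=> Gu e_gt0 t01.
have pA : pd (Phi (G^t* *m G)).
  by apply: Phi_pd; rewrite -[G^t*]mulmx1; exact/pd_congr/pd1.
have pB : pd (Phi (G^t* *m diag_mx e *m G)).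
  by apply: Phi_pd; rewrite -dpow1 //; exact/pd_congr/pd_dpow.
have [H [f [Hu f_gt0 AE BE ->]]] := gmean_diag pA pB.
pose M i := Phi ((row i G)^t* *m row i G).
have PhiE (c : 'rV[C]_d) : (forall i, c 0 i \is Num.real) ->
    Phi (G^t* *m diag_mx c *m G) = \sum_i c 0 i *: M i.
  move=> c_real; rewrite congr_diag_sum Phi_sum // => i.
  by case: (psd_rank1 (row i G)).
rewrite /dpow PhiE => [|i]; last by rewrite mxE gtr0_real ?pw_gt0.
under [X in lowner X]eq_bigr do rewrite mxE.
apply: power_jensen_congr => //.
- by move=> i; exact/Phi_psd/psd_rank1.
(* [G^* G] is [G^* diag(1, ..., 1) G], so [PhiE] applies with all coefficients 1. *)
- rewrite -AE -[G^t*]mulmx1 -diag_const_mx PhiE => [|i]; last by rewrite mxE.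
  by apply: eq_bigr => i _; rewrite mxE scale1r.
- by rewrite -BE PhiE // => i; rewrite gtr0_real.
Qed.

Hypothesis pwV : forall t x, 0 < x -> pw t x^-1 = (pw t x)^-1.

Variable h : 'M[C]_k -> R.
Hypothesis h_mono : forall X Y, pd X -> pd Y -> lowner X Y -> h X <= h Y.
Hypothesis h_geo : forall A B, pd A -> pd B -> forall t, 0 <= t <= 1 ->
  h (gmean A B t) <= (1 - t) * h A + t * h B.

(** Phrased in terms of [G] and [e] so that it serves both the mean itself and its inverse. *)
Lemma geo_convex_diag (G : 'M[C]_d) (e : 'rV[C]_d) t : G \in unitmx ->
  (forall i, 0 < e 0 i) -> 0 <= t <= 1 ->
  h (Phi (G^t* *m dpow e t *m G)) <=
  (1 - t) * h (Phi (G^t* *m G)) + t * h (Phi (G^t* *m diag_mx e *m G)).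
Proof.
move=> Gu e_gt0 t01.
have pA : pd (Phi (G^t* *m G)).
  by apply: Phi_pd; rewrite -[G^t*]mulmx1; exact/pd_congr/pd1.
have pB : pd (Phi (G^t* *m diag_mx e *m G)).
  by apply: Phi_pd; rewrite -dpow1 //; exact/pd_congr/pd_dpow.
apply: le_trans (h_geo pA pB t01); apply: h_mono; last exact: ando_inequality.
- exact/Phi_pd/pd_congr/pd_dpow.
(* The mean of the two images is itself a congruence of a positive diagonal matrix, hence positive
   definite. *)
- have [H [f [Hu f_gt0 _ _ ->]]] := gmean_diag pA pB.
  exact/pd_congr/pd_dpow.
Qed.

Lemma geo_convex_Phi A B t : pd A -> pd B -> 0 <= t <= 1 ->
  h (Phi (gmean A B t)) <= (1 - t) * h (Phi A) + t * h (Phi B).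
Proof.
move=> pA pB t01; have [G [e [Gu e_gt0 -> -> ->]]] := gmean_diag pA pB.
exact: geo_convex_diag.
Qed.

(* Inversion replaces [G] by [G^-*] and [e] by [e^-1]. *)
Lemma geo_convex_Phi_inv A B t : pd A -> pd B -> 0 <= t <= 1 ->
  h (Phi (invmx (gmean A B t))) <=
  (1 - t) * h (Phi (invmx A)) + t * h (Phi (invmx B)).
Proof.
move=> pA pB t01; have [G [e [Gu e_gt0 -> -> ->]]] := gmean_diag pA pB.
pose H := invmx (G^t*); pose e' := map_mx GRing.inv e : 'rV[C]_d.
have HC : H^t* = invmx G by rewrite /H trmxC_inv trmxCK.
have Gu' : G^t* \in unitmx by rewrite trmxC_unit.
have e'_gt0 i : 0 < e' 0 i by rewrite mxE invr_gt0.
have invE s : invmx (G^t* *m dpow e s *m G) = H^t* *m dpow e' s *m H.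
  apply: invmx_eq; rewrite HC !mulmxA mulmxK // -(mulmxA (G^t*)).
  have -> : dpow e s *m dpow e' s = 1%:M.
    rewrite mulmx_diag -diag_const_mx; congr diag_mx; apply/rowP => i.
    by rewrite !mxE pwV // divff // lt0r_neq0 // pw_gt0.
  by rewrite mulmx1 mulmxV.
(* Writing [diag e] as [e^1] and the identity inside [G^* G] as [e^0] lets [invE] compute all three
   inverses. *)
rewrite -(dpow1 e_gt0) -{2}[G^t*]mulmx1 -(dpow0 e_gt0) !invE.
rewrite dpow0 // dpow1 // mulmx1.
by apply: geo_convex_diag => //; rewrite unitmx_inv.
Qed.

End PositiveMap.

End PowerMean.

(** * The concrete power function on complex numbers *)

Section ComplexPower.
Variable R : realType.
Local Notation C := R[i].

(** This is the scalar function inside [mxpowR], so [geomean] and [gmean cpow] agree by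
    conversion. *)
Definition cpow (t : R) (z : C) : C := ((complex.Re z) `^ t)%:C%C.

Lemma Re_gt0 (z : C) : 0 < z -> 0 < complex.Re z.
Proof. by rewrite ltcE => /andP[]. Qed.

Lemma cpow_gt0 t z : 0 < z -> 0 < cpow t z.
Proof. by move=> /Re_gt0 z0; rewrite ltcR powR_gt0. Qed.

Lemma cpowD s t z : 0 < z -> cpow (s + t) z = cpow s z * cpow t z.
Proof.
move=> /Re_gt0 z0; rewrite /cpow powRD ?rmorphM //.
by apply/implyP => _; exact: lt0r_neq0.
Qed.

Lemma cpow1 z : 0 < z -> cpow 1 z = z.
Proof.
by move=> z0; rewrite /cpow powRr1 ?ltW ?Re_gt0 // RRe_real ?gtr0_real.
Qed.

Lemma cpowV t z : 0 < z -> cpow t z^-1 = (cpow t z)^-1.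
Proof.
move=> z0; have Rz := Re_gt0 z0.
have -> : z^-1 = (complex.Re z)^-1%:C%C by rewrite fmorphV /= RRe_real ?gtr0_real.
rewrite /cpow /= -fmorphV -powR_inv1 ?(ltW Rz) // -!powRrM mulN1r.
by rewrite powRN.
Qed.

Lemma continuous_powR_exponent (a : R) : 0 < a -> continuous (powR a).
Proof.
move=> a0 t; have -> : powR a = expR \o (fun s => s * ln a).
  by apply/funext => s; rewrite /powR gt_eqF.
apply: continuous_comp; last exact: continuous_expR.
exact: mulrr_continuous.
Qed.

(** The sum is continuous in the exponent, so a negative value at [t] would persist on a
    neighbourhood, which contains some [s] with a nonnegative sum. *)
Lemma cpow_closure (I : finType) (a c : I -> C) (t : R) :
  (forall i, 0 < a i) -> (forall i, c i \is Num.real) ->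
  (forall eps : R, 0 < eps ->
     exists2 s, `|t - s| < eps & 0 <= \sum_i cpow s (a i) * c i) ->
  0 <= \sum_i cpow t (a i) * c i.
Proof.
move=> a0 c_real cl.
(* All summands are real, so continuity can be argued in [R]. *)
pose g s := \sum_i complex.Re (a i) `^ s * complex.Re (c i).
have gE s : \sum_i cpow s (a i) * c i = (g s)%:C%C.
  rewrite rmorph_sum; apply: eq_bigr => i _.
  by rewrite rmorphM /= (RRe_real (c_real i)).
rewrite gE ler0c leNgt; apply/negP => gt0.
have g_cont : {for t, continuous g}.
  apply: cvg_big => [|i _]; first exact: add_continuous.
  apply: cvgMl; exact/continuous_powR_exponent/Re_gt0.
have /nbhs_ballP[eps /= eps0 g_lt0] : \forall s \near t, g s < 0.
  exact: (cvgr_lt _ g_cont).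
have [s ts] := cl _ eps0.
by rewrite gE ler0c leNgt g_lt0.
Qed.

Lemma psdmxE n (A : 'M[C]_n) : psdmx A <-> psd A.
Proof. by split=> -[/herm_hermsym hA pA]. Qed.

Lemma pdmxE n (A : 'M[C]_n) : pdmx A <-> pd A.
Proof. by split=> -[/herm_hermsym hA pA]. Qed.

Lemma geomeanE n (A B : 'M[C]_n) t : geomean A B t = gmean cpow A B t.
Proof. by []. Qed.

End ComplexPower.

Theorem theorem11 (R : realType) (d k : nat)
  (h : 'M[R[i]]_k -> R) (r : int) (Phi : 'M[R[i]]_d -> 'M[R[i]]_k) :
  (* h nondecreasing in the Loewner order on P_k *)
  (forall X Y : 'M[R[i]]_k, pdmx X -> pdmx Y -> loewner X Y -> h X <= h Y) ->
  (* h geodesically convex on P_k *)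
  geo_convex h ->
  (r = 1 \/ r = -1) ->
  (* Phi : Herm_d -> Herm_k is (real-)linear *)
  (forall A : 'M[R[i]]_d, hermmx A -> hermmx (Phi A)) ->
  (forall (a : R) (A B : 'M[R[i]]_d), hermmx A -> hermmx B ->
     Phi (a%:C%C *: A + B) = a%:C%C *: Phi A + Phi B) ->
  (* Phi positive *)
  (forall A : 'M[R[i]]_d, psdmx A -> psdmx (Phi A)) ->
  (* Phi maps P_d into P_k *)
  (forall A : 'M[R[i]]_d, pdmx A -> pdmx (Phi A)) ->
  geo_convex (fun S : 'M[R[i]]_d => h (Phi (if r == 1 then S else invmx S))).
Proof.
move=> h_mono h_geo r1 _ Phi_lin Phi_psd Phi_pd.
have Phi_lin' (a : R[i]) (A B : 'M[R[i]]_d) : a \is Num.real -> herm A -> herm B ->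
    Phi (a *: A + B) = a *: Phi A + Phi B.
  move=> /complex_realP[x ->] /herm_hermsym hA /herm_hermsym hB.
  exact: Phi_lin.
have Phi_psd' A : psd A -> psd (Phi A) by move=> /psdmxE/Phi_psd/psdmxE.
have Phi_pd' A : pd A -> pd (Phi A) by move=> /pdmxE/Phi_pd/pdmxE.
have h_mono' X Y : pd X -> pd Y -> lowner X Y -> h X <= h Y.
  by move=> /pdmxE pX /pdmxE pY /psdmxE; exact: h_mono.
have h_geo' A B : pd A -> pd B -> forall t : R, 0 <= t <= 1 ->
    h (gmean (@cpow R) A B t) <= (1 - t) * h A + t * h B.
  by move=> /pdmxE pA /pdmxE pB t t01; rewrite -geomeanE; exact: h_geo.
move=> A B /pdmxE pA /pdmxE pB t t01; rewrite geomeanE.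
case: r1 => -> /=.
  exact: (geo_convex_Phi (@cpow_gt0 R) (@cpowD R) (@cpow1 R) (@cpow_closure R)
            Phi_lin' Phi_psd' Phi_pd' h_mono' h_geo').
exact: (geo_convex_Phi_inv (@cpow_gt0 R) (@cpowD R) (@cpow1 R) (@cpow_closure R)
          Phi_lin' Phi_psd' Phi_pd' (@cpowV R) h_mono' h_geo').
Qed.
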